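(* Let $Q$ be a strongly locally finite quiver with a full subquiver $Q'$, and let $k$ be a field. Let $M,N\in\mathrm{Rep}^-(Q)$ be such that $M\oplus N$ is supported by $Q'$ and injective restricted to a full subquiver $\Sigma$ of $Q'$, and let $\Omega$ be a successor-closed subquiver of $Q'$ which contains the socle-support of $(M\oplus N)_\Sigma$ and the augmented complement of $\Sigma$ in $Q'$. (1) $M\cong N$ if and only if $M_\Omega\cong N_\Omega$. (2) $M$ is indecomposable if and only if $M_\Omega$ is indecomposable. (3) A morphism $f:M\to N$ is a section or a retraction if and only if $f_\Omega$ is a section or a retraction, respectively.
   Context: A quiver $Q=(Q_0,Q_1)$ is locally finite if every vertex is the starting point of finitely many arrows and the ending point of finitely many arrows; interval-finite if for all $x,y\in Q_0$ the set $Q(x,y)$ of paths from $x$ to $y$ (including trivial paths) is finite; strongly locally finite if both. $\mathrm{Rep}(Q)$ is the category of all $k$-representations of $Q$; tensor products are over $k$. For $a\in Q_0$, $I_a$ is the representation with $I_a(x)$ the $k$-space with basis $Q(x,a)$, where for an arrow $\alpha:x\to y$ the map $I_a(\alpha)$ sends $\rho\alpha$ to $\rho$ and vanishes on paths not factoring through $\alpha$. $\mathrm{Inj}(Q)$ is the full additive subcategory of $\mathrm{Rep}(Q)$ generated by the objects isomorphic to $I_a\otimes U$ with $a\in Q_0$, $U$ a $k$-space. $\mathrm{Rep}^-(Q)$ is the full subcategory of $\mathrm{Rep}(Q)$ of almost finitely co-presented objects, i.e. those $M$ admitting an exact sequence $0\to M\to I_0\to I_1\to0$ with $I_0,I_1\in\mathrm{Inj}(Q)$.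 The support $\mathrm{supp}\,M$ is the full subquiver of $Q$ generated by the $x$ with $M(x)\ne0$; $M$ is supported by a subquiver $\Sigma$ if $\mathrm{supp}\,M\subseteq\Sigma$. The socle $\mathrm{soc}\,M$ is the subrepresentation with $(\mathrm{soc}\,M)(x)$ the intersection of the kernels of the maps $M(\alpha)$, $\alpha$ running over the arrows starting at $x$; the socle-support of $M$ is the support of $\mathrm{soc}\,M$. The restriction $M_\Sigma\in\mathrm{Rep}(Q)$ agrees with $M$ on the vertices and arrows of $\Sigma$ and is $0$ elsewhere; for a morphism $f$, $f_\Sigma(x)=f(x)$ if $x\in\Sigma_0$ and $f_\Sigma(x)=0$ otherwise. $M$ is injective restricted to a full subquiver $\Sigma$ if $M_\Sigma\in\mathrm{Inj}(Q)$. A subquiver $\Omega$ of $Q'$ is successor-closed in $Q'$ if every path in $Q'$ starting at a vertex of $\Omega$ lies entirely in $\Omega$. The augmented complement of $\Sigma$ in $Q'$ is the full subquiver of $Q'$ generated by the vertices and arrows of $Q'$ not in $\Sigma$; thus a vertex $x\in\Sigma_0$ belongs to it if and only if there is an arrow of $Q'$ (in either direction) joining $x$ to a vertex $y\notin\Sigma_0$. A section is a split monomorphism and a retraction is a split epimorphism. *)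

(* Defs.v *)
From HB Require Import structures.
From mathcomp Require Import all_boot all_order all_algebra.
From mathcomp Require Import boolp classical_sets functions cardinality.
From mathcomp Require Import freeg.

Set Implicit Arguments.
Unset Strict Implicit.
Unset Printing Implicit Defensive.

Import GRing.Theory.
Local Open Scope ring_scope.
Local Open Scope classical_set_scope.

Record quiver := Quiver {
  vertex :> Type;
  arrow : vertex -> vertex -> Type
}.

(** Paths are written from their source: [pcons a r] is the composite [r a],
    the arrow [a] followed by the path [r]. *)
Inductive qpath (Q : quiver) : Q -> Q -> Type :=
| ptriv x : qpath x x
| pcons x y z (a : arrow x y) (r : qpath y z) : qpath x z.

HB.instance Definition _ (Q : quiver) (x y : Q) := gen_eqMixin (qpath x y).
HB.instance Definition _ (Q : quiver) (x y : Q) := gen_choiceMixin (qpath x y).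

Definition locally_finite (Q : quiver) : Prop := forall x : Q,
  finite_set [set: {y : Q & arrow x y}] /\ finite_set [set: {y : Q & arrow y x}].

Definition interval_finite (Q : quiver) : Prop :=
  forall x y : Q, finite_set [set: qpath x y].

Definition strongly_locally_finite (Q : quiver) : Prop :=
  locally_finite Q /\ interval_finite Q.

Record subquiver (Q : quiver) := Subquiver {
  svertex : set Q;
  sarrow : forall x y : Q, set (arrow x y);
  sarrow_src : forall x y (a : arrow x y), sarrow a -> svertex x;
  sarrow_tgt : forall x y (a : arrow x y), sarrow a -> svertex y
}.

Section Subquivers.
Variable Q : quiver.
Implicit Types S T : subquiver Q.

Definition subquiver_le S T : Prop :=
  svertex S `<=` svertex T /\ forall x y : Q, @sarrow Q S x y `<=` @sarrow Q T x y.

Definition whole : subquiver Q :=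
  @Subquiver Q setT (fun _ _ => setT) (fun _ _ _ _ => I) (fun _ _ _ _ => I).

Definition full_on T (X : set Q) : subquiver Q :=
  @Subquiver Q (svertex T `&` X)
    (fun x y => [set a : arrow x y | [/\ sarrow T a, X x & X y]])
    (fun x y a h => let: And3 ha hx _ := h in conj (sarrow_src ha) hx)
    (fun x y a h => let: And3 ha _ hy := h in conj (sarrow_tgt ha) hy).

Definition full_subquiver S T : Prop :=
  subquiver_le S T /\
  forall (x y : Q) (a : arrow x y),
    svertex S x -> svertex S y -> sarrow T a -> sarrow S a.

Fixpoint path_in S (x y : Q) (p : qpath x y) : Prop :=
  match p with
  | ptriv z => svertex S z
  | pcons _ _ _ a r => sarrow S a /\ path_in S r
  end.

Definition successor_closed S T : Prop :=
  subquiver_le S T /\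
  forall (x y : Q) (p : qpath x y), svertex S x -> path_in T p -> path_in S p.

Definition augmented_complement S T : subquiver Q :=
  full_on T [set x |
    [\/ svertex T x /\ ~ svertex S x,
        exists y (a : arrow x y), sarrow T a /\ ~ sarrow S a
      | exists y (a : arrow y x), sarrow T a /\ ~ sarrow S a]].

End Subquivers.

Record rep (k : fieldType) (Q : quiver) := Rep {
  rspace :> Q -> lmodType k;
  rmap : forall x y : Q, arrow x y -> {linear rspace x -> rspace y}
}.

Record rhom (k : fieldType) (Q : quiver) (M N : rep k Q) := RHom {
  rhom_fun :> forall x : Q, {linear M x -> N x};
  rhom_comm : forall (x y : Q) (a : arrow x y) (v : M x),
    rhom_fun y (rmap M a v) = rmap N a (rhom_fun x v)
}.

Section Category.
Variables (k : fieldType) (Q : quiver).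
Implicit Types M N L : rep k Q.

Lemma rhom_id_comm M (x y : Q) (a : arrow x y) (v : M x) :
  idfun (rmap M a v) = rmap M a (idfun v).
Proof. by []. Qed.

Definition rhom_id M : rhom M M :=
  @RHom k Q M M (fun _ => idfun) (@rhom_id_comm M).

Lemma rhom_comp_comm M N L (g : rhom N L) (f : rhom M N)
    (x y : Q) (a : arrow x y) (v : M x) :
  (g y \o f y) (rmap M a v) = rmap L a ((g x \o f x) v).
Proof. by rewrite /= !rhom_comm. Qed.

Definition rhom_comp M N L (g : rhom N L) (f : rhom M N) : rhom M L :=
  @RHom k Q M L (fun x => (g x \o f x)) (@rhom_comp_comm M N L g f).

Definition rhom_eq M N (f g : rhom M N) : Prop :=
  forall (x : Q) (v : M x), f x v = g x v.

Definition is_section M N (f : rhom M N) : Prop :=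
  exists g : rhom N M, rhom_eq (rhom_comp g f) (rhom_id M).

Definition is_retraction M N (f : rhom M N) : Prop :=
  exists g : rhom N M, rhom_eq (rhom_comp f g) (rhom_id N).

Definition isomorphic M N : Prop :=
  exists (f : rhom M N) (g : rhom N M),
    rhom_eq (rhom_comp g f) (rhom_id M) /\ rhom_eq (rhom_comp f g) (rhom_id N).

Definition rep0 : rep k Q := @Rep k Q (fun _ => 'rV[k]_0) (fun _ _ _ => \0).

Definition nonzero_at M (x : Q) : Prop := exists v : M x, v != 0.

Definition is_zero M : Prop := forall x : Q, ~ nonzero_at M x.

Section DirectSum.
Variables (M N : rep k Q) (x y : Q) (a : arrow x y).

Definition dsum_map (v : M x * N x) : M y * N y := (rmap M a v.1, rmap N a v.2).

Lemma dsum_map_linear : linear dsum_map.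
Proof. by move=> c u v; rewrite /dsum_map /= !linearP. Qed.

HB.instance Definition _ := GRing.isLinear.Build k (M x * N x)%type
  (M y * N y)%type *:%R dsum_map dsum_map_linear.
End DirectSum.

Definition dsum M N : rep k Q :=
  @Rep k Q (fun x => (M x * N x)%type) (fun x y a => @dsum_map M N x y a).

Definition indecomposable M : Prop :=
  ~ is_zero M /\
  forall A B : rep k Q, isomorphic M (dsum A B) -> is_zero A \/ is_zero B.

Definition short_exact M N L (f : rhom M N) (g : rhom N L) : Prop :=
  forall x : Q, [/\ injective (f x),
    forall v : N x, g x v = 0 <-> exists u : M x, f x u = v
    & forall w : L x, exists v : N x, g x v = w].

End Category.

Section Socle.
Variables (k : fieldType) (Q : quiver) (M : rep k Q).

Definition supp : subquiver Q := full_on (whole Q) [set x | nonzero_at M x].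

Definition supported_by (S : subquiver Q) : Prop := subquiver_le supp S.

Definition in_soc (x : Q) : {pred M x} :=
  fun v => `[< forall (y : Q) (a : arrow x y), rmap M a v = 0 >].

Lemma in_soc_submod (x : Q) : submod_closed (@in_soc x).
Proof.
split=> [|c u v /asboolP hu /asboolP hv].
  by apply/asboolP => y a; rewrite linear0.
by apply/asboolP => y a; rewrite linearP hu hv scaler0 addr0.
Qed.

HB.instance Definition _ (x : Q) :=
  GRing.isSubmodClosed.Build k (M x) (@in_soc x) (@in_soc_submod x).

Definition soc_space (x : Q) := {v : M x | v \in @in_soc x}.

HB.instance Definition _ (x : Q) := SubChoice.on (soc_space x).
HB.instance Definition _ (x : Q) :=
  [SubChoice_isSubLmodule of soc_space x by <:].

Section SocMap.
Variables (x y : Q) (a : arrow x y).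

Lemma soc_map_subproof (v : soc_space x) : rmap M a (val v) \in @in_soc y.
Proof.
case: v => v /= /asboolP hv; apply/asboolP => z b.
by rewrite hv linear0.
Qed.

Definition soc_map (v : soc_space x) : soc_space y :=
  Sub (rmap M a (val v)) (soc_map_subproof v).

Lemma soc_map_linear : linear soc_map.
Proof. by move=> c u v; apply: val_inj; rewrite /= !linearP. Qed.

HB.instance Definition _ := GRing.isLinear.Build k (soc_space x)
  (soc_space y) *:%R soc_map soc_map_linear.
End SocMap.

Definition soc : rep k Q := @Rep k Q soc_space (fun x y a => soc_map a).

End Socle.

Definition socle_support (k : fieldType) (Q : quiver) (M : rep k Q) :
  subquiver Q := supp (soc M).

Section Cutoff.
Variables (k : fieldType) (P : Prop) (V : lmodType k).

(** [cutoff P V] is [V] if [P] holds and the zero space otherwise; [cut_in]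
    and [cut_out] are then the identity, respectively the zero maps. *)
Definition cutoff : lmodType k := if `[< P >] then V else 'rV[k]_0.

Definition cut_in : {linear V -> cutoff} :=
  match `[< P >] as b return {linear V -> (if b then V else 'rV[k]_0)} with
  | true => idfun
  | false => \0
  end.

Definition cut_out : {linear cutoff -> V} :=
  match `[< P >] as b return {linear (if b then V else 'rV[k]_0) -> V} with
  | true => idfun
  | false => \0
  end.

Lemma cut_inK : P -> cancel cut_in cut_out.
Proof.
by move=> /asboolP h; rewrite /cut_in /cut_out /cutoff; case: `[< P >] h.
Qed.

Lemma cut_outK : cancel cut_out cut_in.
Proof.
rewrite /cut_in /cut_out /cutoff => v; case: `[< P >] v => //= v.
by apply/rowP => -[].
Qed.

End Cutoff.

Section Restriction.
Variables (k : fieldType) (Q : quiver).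
Implicit Types (M N : rep k Q) (S : subquiver Q).

Definition restr_space M S (x : Q) : lmodType k := cutoff (svertex S x) (M x).

Definition restr_map M S (x y : Q) (a : arrow x y) :
    {linear restr_space M S x -> restr_space M S y} :=
  match `[< sarrow S a >] with
  | true =>
      cut_in (svertex S y) (M y) \o (rmap M a \o cut_out (svertex S x) (M x))
  | false => \0
  end.

Definition restr M S : rep k Q :=
  @Rep k Q (restr_space M S) (@restr_map M S).

Definition restr_rhom_fun M N (f : rhom M N) S (x : Q) :
    {linear restr M S x -> restr N S x} :=
  cut_in (svertex S x) (N x) \o (f x \o cut_out (svertex S x) (M x)).

Lemma restr_rhom_comm M N (f : rhom M N) S (x y : Q) (a : arrow x y)
    (v : restr M S x) :
  restr_rhom_fun f S y (rmap (restr M S) a v) =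
  rmap (restr N S) a (restr_rhom_fun f S x v).
Proof.
rewrite /= /restr_map; case: asboolP => [h|_]; last by rewrite /= !linear0.
by rewrite /= cut_inK ?cut_inK ?rhom_comm //;
  [exact: sarrow_src h | exact: sarrow_tgt h].
Qed.

Definition restr_rhom M N (f : rhom M N) S : rhom (restr M S) (restr N S) :=
  @RHom k Q (restr M S) (restr N S) (restr_rhom_fun f S)
    (@restr_rhom_comm M N f S).

End Restriction.

Section Injective.
Variable Q : quiver.

Lemma pcons_inj (x y z : Q) (a : arrow x y) :
  injective (@pcons Q x y z a).
Proof.
move=> r r' e.
have h : existT (fun t : Q => qpath t z) y r = existT _ y r'.
  exact: (f_equal (fun p : qpath x z =>
    match p in qpath _ t return {u : Q & qpath u t} with
    | ptriv t => existT (fun u => qpath u t) t (ptriv t)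
    | pcons _ u t _ s => existT (fun u => qpath u t) u s
    end) e).
by have := projT2_eq h; rewrite (Prop_irrelevance (projT1_eq h) erefl).
Qed.

(** The path [r] such that [p] is [r a], if any. *)
Definition pfactor (x y z : Q) (a : arrow x y) (p : qpath x z) :
    option (qpath y z) :=
  if pselect (exists r, p = pcons a r) is left h then Some (projT1 (cid h))
  else None.

Lemma pfactor_cons (x y z : Q) (a : arrow x y) (r : qpath y z) :
  pfactor a (pcons a r) = Some r.
Proof.
rewrite /pfactor; case: pselect => [h|[]]; last by exists r.
by case: cid => s /= /pcons_inj ->.
Qed.

Lemma pfactor_none (x y z : Q) (a : arrow x y) (p : qpath x z) :
  (forall r, p <> pcons a r) -> pfactor a p = None.
Proof. by rewrite /pfactor => h; case: pselect => // e; exfalso; case: e. Qed.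

Variable k : fieldType.

Section InjMap.
Variables (c x y : Q) (a : arrow x y).

Definition inj_map : {freeg (qpath x c) / k} -> {freeg (qpath y c) / k} :=
  fglift (fun p => if pfactor a p is Some r then << r >> else 0).

Lemma inj_map_linear : linear inj_map.
Proof.
move=> l D E; rewrite /inj_map; set F := fun _ => _.
have fgB := @lift_is_additive k _ {freeg (qpath y c) / k} F.
have fg0 : fglift F 0 = 0 by rewrite -(subrr 0) fgB subrr.
have fgN D' : fglift F (- D') = - fglift F D' by rewrite -sub0r fgB fg0 sub0r.
have fgD D1 D2 : fglift F (D1 + D2) = fglift F D1 + fglift F D2.
  by rewrite -{1}[D2]opprK fgB fgN opprK.
rewrite fgD; congr (_ + _).
have -> : l *: D = \sum_(p <- dom D) << l * coeff p D *g p >> by [].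
rewrite -{3}[D]freeg_sumE.
rewrite (big_morph _ fgD fg0) (big_morph _ fgD fg0) scaler_sumr.
by apply: eq_bigr => p _; rewrite !liftU scalerA.
Qed.

HB.instance Definition _ := GRing.isLinear.Build k {freeg (qpath x c) / k}
  {freeg (qpath y c) / k} *:%R inj_map inj_map_linear.

Lemma inj_map_cons (r : qpath y c) : inj_map << pcons a r >> = << r >>.
Proof. by rewrite /inj_map liftU scale1r pfactor_cons. Qed.

Lemma inj_map_other (p : qpath x c) :
  (forall r, p <> pcons a r) -> inj_map << p >> = 0.
Proof. by move=> h; rewrite /inj_map liftU scale1r pfactor_none. Qed.
End InjMap.

(** The representation [I_c]. *)
Definition inj_rep (c : Q) : rep k Q :=
  @Rep k Q (fun x => {freeg (qpath x c) / k}) (fun x y a => @inj_map c x y a).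

End Injective.

(** [b] exhibits [T] as the tensor product of [V] and [U]. *)
Definition is_tensor (k : fieldType) (V U T : lmodType k)
    (b : {bilinear V -> U -> T}) : Prop :=
  forall (W : lmodType k) (c : {bilinear V -> U -> W}),
    exists2 h : {linear T -> W},
      forall v u, h (b v u) = c v u
    & forall h' : {linear T -> W}, (forall v u, h' (b v u) = c v u) -> h' =1 h.

(** [J] is isomorphic to [M (x) U]: each [J x] is a tensor product of [M x] and
    [U], and [J a] is [M a (x) id]. *)
Definition is_tensor_rep (k : fieldType) (Q : quiver) (M : rep k Q)
    (U : lmodType k) (J : rep k Q) : Prop :=
  exists b : forall x : Q, {bilinear M x -> U -> J x},
    (forall x : Q, is_tensor (b x)) /\
    forall (x y : Q) (a : arrow x y) (v : M x) (u : U),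
      rmap J a (b x v u) = b y (rmap M a v) u.

(** The additive subcategory generated by the [I_c (x) U]: closure under the
    zero object, binary direct sums and isomorphism. *)
Inductive in_Inj (k : fieldType) (Q : quiver) : rep k Q -> Prop :=
| in_Inj_gen (c : Q) (U : lmodType k) (J : rep k Q) :
    is_tensor_rep (inj_rep k c) U J -> in_Inj J
| in_Inj_zero : in_Inj (rep0 k Q)
| in_Inj_dsum (I J : rep k Q) : in_Inj I -> in_Inj J -> in_Inj (dsum I J)
| in_Inj_iso (I J : rep k Q) : isomorphic I J -> in_Inj I -> in_Inj J.

(** Almost finitely co-presented representations. *)
Definition in_Rep_minus (k : fieldType) (Q : quiver) (M : rep k Q) : Prop :=
  exists (I0 I1 : rep k Q) (f : rhom M I0) (g : rhom I0 I1),
    [/\ in_Inj I0, in_Inj I1 & short_exact f g].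

Definition injective_restricted (k : fieldType) (Q : quiver) (M : rep k Q)
  (S : subquiver Q) : Prop := in_Inj (restr M S).

(* Main.v *)
(** The objects of [Inj(Q)] have two properties. First, since [Q] is
    interval-finite, [I_c (x) U] is the representation [Hom_k(kQ(-, c), U)]
    coinduced from [c], hence morphisms into it extend along any morphism that
    is bijective at [c]; when [U] is nonzero, [c] lies in the socle-support.
    Second, each vertex [x] has a bound on the length of the paths starting at
    [x] that act nontrivially.

    The first property extends a morphism [M_Omega -> N_Omega], viewed on
    [Sigma], to [M_Sigma -> N_Sigma]; as every arrow of [Q'] at a vertex
    outside [Omega] lies in [Sigma], this glues to a morphism [M -> N], so
    restriction to [Omega] is full. The second property shows that an
    endomorphism vanishing on [Omega] kills the socle on [Sigma], hence lowers
    the socle filtration and is locally nilpotent. So endomorphisms restricting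
    to the identity are invertible, and an idempotent of [End(M_Omega)] lifts to
    some [h] with [h (1 - h)] locally nilpotent, which yields a Fitting
    decomposition of [M]. *)
Require Import Defs.
From HB Require Import structures.
From mathcomp Require Import all_boot all_order all_algebra.
From mathcomp Require Import boolp classical_sets cardinality.
From mathcomp Require Import freeg.

Set Implicit Arguments.
Unset Strict Implicit.
Unset Printing Implicit Defensive.

Import GRing.Theory.
Local Open Scope ring_scope.
Local Open Scope classical_set_scope.

(** * Linear and bilinear maps obtained from functions and graphs *)

Lemma dependent_choice_prop (I : Type) (T : I -> Type) (P : forall i, T i -> Prop) :
  (forall i, exists y, P i y) -> exists f, forall i, P i (f i).
Proof. by move=> h; exists (fun i => projT1 (cid (h i))) => i; case: cid. Qed.

Section LinearMaps.
Variable k : fieldType.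

Lemma linear_of (V W : lmodType k) (f : V -> W) :
  linear f -> exists g : {linear V -> W}, g =1 f.
Proof.
move=> hf; pose h := GRing.isLinear.Build k V W *:%R f hf.
by exists (HB.pack_for {linear V -> W} f h).
Qed.

(** Uniqueness of the value makes any choice function linear. This serves where a vector is
    characterised by its values along paths. *)
Lemma linear_graph (V W : lmodType k) (P : V -> W -> Prop) :
  (forall v, exists w, P v w) ->
  (forall v w w', P v w -> P v w' -> w = w') ->
  (forall a v v' w w', P v w -> P v' w' -> P (a *: v + v') (a *: w + w')) ->
  exists g : {linear V -> W}, forall v, P v (g v).
Proof.
move=> /choice[f Pf] uniqP linP.
have hf : linear f by move=> a u v; apply: (uniqP _ _ _ (Pf _)); apply: linP.
by have [g fg] := linear_of hf; exists g => v; rewrite fg.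
Qed.

Lemma bilinear_of (U V W : lmodType k) (f : U -> V -> W) :
  (forall v, linear (f^~ v)) -> (forall u, linear (f u)) ->
  exists g : {bilinear U -> V -> W}, forall u v, g u v = f u v.
Proof.
move=> hl hr.
have hf : bilinear_for *:%R *:%R f by split=> [v|u] a x y; rewrite ?hl ?hr.
pose h := bilinear_isBilinear.Build k U V W *:%R *:%R f hf.
by exists (HB.pack_for {bilinear U -> V -> W} f h).
Qed.

End LinearMaps.

(** * Action of paths, and tensor products as coinduced representations *)

Section Paths.
Variables (k : fieldType) (Q : quiver).

Fixpoint rpath (M : rep k Q) (x y : Q) (p : qpath x y) : {linear M x -> M y} :=
  match p with
  | ptriv _ => idfun
  | pcons _ _ _ a r => rpath M r \o rmap M a
  end.

Lemma rpath_comm (M N : rep k Q) (f : rhom M N) (x y : Q) (p : qpath x y)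
    (v : M x) : f y (rpath M p v) = rpath N p (f x v).
Proof. by elim: p v => //= x' y' z a r IH v; rewrite IH rhom_comm. Qed.

Fixpoint qcat (x y z : Q) (p : qpath x y) : qpath y z -> qpath x z :=
  match p with
  | ptriv _ => id
  | pcons _ _ _ a r => fun q => pcons a (qcat r q)
  end.

Fixpoint qlen (x y : Q) (p : qpath x y) : nat :=
  match p with ptriv _ => 0 | pcons _ _ _ _ r => (qlen r).+1 end.

Lemma qlen_cat (x y z : Q) (p : qpath x y) (q : qpath y z) :
  qlen (qcat p q) = (qlen p + qlen q)%N.
Proof. by elim: p q => //= x' y' z' a r IH q; rewrite IH. Qed.

Lemma rpath_cat (M : rep k Q) (x y z : Q) (p : qpath x y) (q : qpath y z)
    (v : M x) : rpath M (qcat p q) v = rpath M q (rpath M p v).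
Proof. by elim: p q v => //= x' y' z' a r IH q v; rewrite IH. Qed.

(** The universal property of [Hom_k(kQ(-, c), U)]: this is [I_c (x) U], as
    all the path sets [Q(x, c)] are finite. *)
Definition coinduced (c : Q) (U : lmodType k) (J : rep k Q) : Prop :=
  exists e : {linear J c -> U},
    (forall x (u : qpath x c -> U), exists v : J x,
       forall p, e (rpath J p v) = u p) /\
    (forall x (v : J x), (forall p : qpath x c, e (rpath J p v) = 0) -> v = 0).

Lemma coeff_inj_map (c x y : Q) (a : arrow x y) (q : qpath y c)
    (D : {freeg (qpath x c) / k}) :
  coeff q (Defs.inj_map a D) = coeff (pcons a q) D.
Proof.
rewrite -{1 2}[D]freeg_sumE linear_sum !raddf_sum; apply: eq_bigr => p _ /=.
have -> : << coeff p D *g p >> = coeff p D *: << p >> :> {freeg (qpath x c) / k}.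
  by apply/eqP/freeg_eqP => r; rewrite coeffZ !coeffU mul1r.
rewrite linearZ /= !coeffZ; congr (_ * _); rewrite coeffU mul1r.
have [[r ->]|nr] := pselect (exists r, p = pcons a r).
  rewrite inj_map_cons coeffU mul1r; congr (nat_of_bool _)%:R.
  by apply/eqP/eqP => [->//|/pcons_inj].
rewrite inj_map_other ?coeff0; last by move=> r e; apply: nr; exists r.
by case: eqP => // e; case: nr; exists q.
Qed.

Lemma coeff_rpath (c x y : Q) (p : qpath x y) (q : qpath y c)
    (D : {freeg (qpath x c) / k}) :
  coeff q (rpath (inj_rep k c) p D) = coeff (qcat p q) D.
Proof. by elim: p q D => //= x' y' z a r IH q D; rewrite IH coeff_inj_map. Qed.

Lemma qcat_triv (x y : Q) (p : qpath x y) : qcat p (ptriv y) = p.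
Proof. by elim: p => //= x' y' z a r ->. Qed.

(** The map [e] sends [b c D u] to [u] scaled by the coefficient of the trivial path in [D]; after a
    path [p] to [c] it reads off the coefficient of [p]. As each $Q(x,c)$ is finite, arbitrary
    values along paths are realised by a finite sum of pure tensors. *)
Lemma tensor_coinduced (c : Q) (U : lmodType k) (J : rep k Q) :
  interval_finite Q -> is_tensor_rep (inj_rep k c) U J -> coinduced c U J.
Proof.
move=> fQ [b [bT bJ]].
have [cf cfE] : exists g : {bilinear inj_rep k c c -> U -> U},
    forall D u, g D u = coeff (ptriv c) D *: u.
  apply: bilinear_of => [v|u] a x y /=.
    by rewrite coeffD coeffZ scalerDl scalerA.
  by rewrite scalerDr !scalerA mulrC.
have [e eE _] := bT c U cf; exists e.
have bpath x y (p : qpath x y) v u :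
    rpath J p (b x v u) = b y (rpath (inj_rep k c) p v) u.
  by elim: p v u => //= x' y' z a r IH v u; rewrite bJ IH.
have eb x (p : qpath x c) v u : e (rpath J p (b x v u)) = coeff p v *: u.
  by rewrite bpath eE cfE coeff_rpath qcat_triv.
have ebU x (p q : qpath x c) u :
    e (rpath J p (b x << q >> u)) = if q == p then u else 0.
  by rewrite eb coeffU mul1r; case: eqP; rewrite ?scale1r ?scale0r.
have /all_sig[s sP] x : {s : seq (qpath x c) | uniq s & forall p, p \in s}.
  apply: cid2; have /finite_seqP[s es] := fQ x c.
  exists (undup s) => [|p]; first exact: undup_uniq.
  by rewrite mem_undup; have : [set` s] p by rewrite -es.
have sum1 (W : lmodType k) x (p : qpath x c) (F : qpath x c -> W) :
    \sum_(q <- s x) (if q == p then F q else 0) = F p.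
  have [us ms] := sP x.
  by rewrite -big_mkcond -big_filter filter_pred1_uniq ?ms // big_seq1.
split=> [x u|x v hv].
  exists (\sum_(q <- s x) b x << q >> (u q)) => p.
  rewrite !linear_sum /= -[RHS](sum1 U x p u).
  by apply: eq_bigr => q _; rewrite ebU.
(* The map [g] rebuilds a vector from its values along paths. It agrees with the identity on pure
   tensors, hence everywhere by the uniqueness in the universal property. *)
have [g gE] : exists g : {linear J x -> J x},
    forall v, g v = \sum_(q <- s x) b x << q >> (e (rpath J q v)).
  apply: linear_of => a w w'; rewrite scaler_sumr -big_split /=.
  by apply: eq_bigr => q _; rewrite !linearP.
have [h _ hU] := bT x (J x) (b x).
have -> : v = g v.
  rewrite [LHS](hU idfun) // (hU g) // => D u; rewrite gE.
  have {2}-> : D = \sum_(q <- s x) coeff q D *: << q >>.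
    apply/eqP/freeg_eqP => r.
    rewrite raddf_sum /= -[LHS](sum1 (GRing.regular k) x r (fun q => coeff q D)).
    apply: eq_bigr => q _.
    by rewrite coeffZ coeffU mul1r; case: eqP => [->|_]; rewrite ?mulr1 ?mulr0.
  rewrite linear_sumlz; apply: eq_bigr => q _.
  by rewrite eb linearZr_LR linearZl_LR.
by rewrite gE big1 // => q _; rewrite hv linear0r.
Qed.

End Paths.

(** * Morphisms, relative injectivity and path-nilpotency of the objects of $\mathrm{Inj}(Q)$ *)

Section Morphisms.
Variables (k : fieldType) (Q : quiver).
Implicit Types M N L A B J K : rep k Q.

Lemma rhom_of M N (f : forall x, M x -> N x) :
  (forall x, linear (f x)) ->
  (forall x y (a : arrow x y) v, f y (rmap M a v) = rmap N a (f x v)) ->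
  exists g : rhom M N, forall x v, g x v = f x v.
Proof.
move=> fl fa; have [g gE] := dependent_choice_prop (fun x => linear_of (fl x)).
have gc x y (a : arrow x y) v : g y (rmap M a v) = rmap N a (g x v).
  by rewrite !gE fa.
by exists (RHom gc) => x v /=; rewrite gE.
Qed.

Lemma rhom_inv M N (f : rhom M N) :
  (forall x, injective (f x)) -> (forall x w, exists v, f x v = w) ->
  exists g : rhom N M, rhom_eq (rhom_comp g f) (rhom_id M) /\
    rhom_eq (rhom_comp f g) (rhom_id N).
Proof.
move=> fI fS.
have [g' gE] : exists g : forall x, N x -> M x, forall x w, f x (g x w) = w.
  by exists (fun x w => projT1 (cid (fS x w))) => x w; case: cid.
have [x a u v|x y a v|g gg'] := @rhom_of N M g'.
- by apply: fI; rewrite linearP !gE.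
- by apply: fI; rewrite rhom_comm !gE.
by exists g; split=> x v /=; rewrite gg' ?gE //; apply: fI; rewrite gE.
Qed.

Lemma isomorphic_of_bij M N (f : rhom M N) :
  (forall x, injective (f x)) -> (forall x w, exists v, f x v = w) ->
  isomorphic M N.
Proof. by move=> fI fS; have [g gf] := rhom_inv fI fS; exists f, g. Qed.

Lemma dsum_fst M N : exists f : rhom (dsum M N) M, forall x v, f x v = v.1.
Proof. exact: rhom_of. Qed.

Lemma dsum_snd M N : exists f : rhom (dsum M N) N, forall x v, f x v = v.2.
Proof. exact: rhom_of. Qed.

Lemma dsum_pair L M N (f : rhom L M) (g : rhom L N) :
  exists h : rhom L (dsum M N), forall x v, h x v = (f x v, g x v).
Proof.
by apply: rhom_of => [x c u v|x y a v]; rewrite /dsum_map ?linearP ?rhom_comm.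
Qed.

Lemma dsum_copair L M N (f : rhom M L) (g : rhom N L) :
  exists h : rhom (dsum M N) L, forall x v, h x v = f x v.1 + g x v.2.
Proof.
apply: rhom_of => [x c u v|x y a v] /=.
  by rewrite !linearP scalerDr addrACA.
by rewrite !rhom_comm linearD.
Qed.

Lemma rhom_zero M N : exists h : rhom M N, forall x v, h x v = 0.
Proof.
by apply: rhom_of => [x c u v|x y a v]; rewrite ?linear0 ?scaler0 ?addr0.
Qed.

Lemma dsum_inl M N : exists f : rhom M (dsum M N), forall x v, f x v = (v, 0).
Proof.
have [z z0] := rhom_zero M N; have [h hE] := dsum_pair (rhom_id M) z.
by exists h => x v; rewrite hE z0.
Qed.

Lemma dsum_inr M N : exists f : rhom N (dsum M N), forall x v, f x v = (0, v).
Proof.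
have [z z0] := rhom_zero N M; have [h hE] := dsum_pair z (rhom_id N).
by exists h => x v; rewrite hE z0.
Qed.

Definition socle_in (X : set Q) M : Prop :=
  forall x (v : M x), (forall y (a : arrow x y), rmap M a v = 0) -> v != 0 -> X x.

(** Bijectivity of [i] is asked only on [X]: a morphism into a representation coinduced from [c] is
    determined by its component at [c]. *)
Definition rel_injective (X : set Q) J : Prop :=
  forall A B (i : rhom A B), (forall x, X x -> bijective (i x)) ->
  forall f : rhom A J, exists g : rhom B J, rhom_eq (rhom_comp g i) f.

Definition path_nilpotent M : Prop :=
  forall x, exists d, forall y (p : qpath x y), (d <= qlen p)%N ->
  forall v, rpath M p v = 0.

Lemma socle_in_mono X M N (f : rhom M N) :
  (forall x, injective (f x)) -> socle_in X N -> socle_in X M.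
Proof.
move=> fI sN x v v0 vN0; apply: (sN x (f x v)) => [y a|].
  by rewrite -rhom_comm v0 linear0.
by apply: contra_neq vN0 => e; apply: (fI x); rewrite e linear0.
Qed.

Lemma path_nilpotent_mono M N (f : rhom M N) :
  (forall x, injective (f x)) -> path_nilpotent N -> path_nilpotent M.
Proof.
move=> fI nN x; have [d dN] := nN x; exists d => y p dp v.
by apply: (fI y); rewrite rpath_comm dN // linear0.
Qed.

Lemma rel_injective_retract X J K (s : rhom K J) (r : rhom J K) :
  rhom_eq (rhom_comp r s) (rhom_id K) -> rel_injective X J -> rel_injective X K.
Proof.
move=> rs iJ A B i ib f; have [g gi] := iJ A B i ib (rhom_comp s f).
by exists (rhom_comp r g) => x v /=; rewrite [g x _]gi; apply: rs.
Qed.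

Lemma section_inj M N (f : rhom M N) (g : rhom N M) :
  rhom_eq (rhom_comp g f) (rhom_id M) -> forall x, injective (f x).
Proof. by move=> gf x u v e; rewrite -[u]gf -[v]gf /= e. Qed.

Lemma dsum_inl_inj M N (f : rhom M (dsum M N)) :
  (forall x v, f x v = (v, 0)) -> forall x, injective (f x).
Proof. by move=> fE x u v; rewrite !fE => -[]. Qed.

Lemma dsum_inr_inj M N (f : rhom N (dsum M N)) :
  (forall x v, f x v = (0, v)) -> forall x, injective (f x).
Proof. by move=> fE x u v; rewrite !fE => -[]. Qed.

(** Morphisms [B -> J] correspond to linear maps [B c -> U]. If [c] lies in [X], the extension of
    [f] corresponds to [e] after [f c] after the inverse of [i c]; otherwise the socle condition
    forces [J] to vanish. *)
Lemma coinduced_rel_injective c (U : lmodType k) J X :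
  coinduced c U J -> socle_in X J -> rel_injective X J.
Proof.
move=> [e [eS eI]] sJ A B i ib f.
have eU x (v w : J x) :
    (forall p, e (rpath J p v) = e (rpath J p w)) -> v = w.
  move=> h; apply/eqP; rewrite -subr_eq0; apply/eqP; apply: eI => p.
  by rewrite !linearB /= h subrr.
have [Xc|nXc] := pselect (X c); last first.
  (* The vector with value [u] on the trivial path and 0 on all longer ones is killed by every
     arrow. It is thus a socle vector at [c], which vanishes as [c] is outside [X]. *)
  have U0 (u : U) : u = 0.
    pose isnil (p : qpath c c) := `[< qlen p = 0%N >].
    have [v ve] := eS c (fun p => if isnil p then u else 0).
    have v0 : v = 0.
      apply/eqP; apply: contra_notT nXc => vN0; apply: (sJ c v) => // y a.
      apply: eI => p; rewrite -[rpath J p _]/(rpath J (pcons a p) v) ve.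
      by rewrite /isnil; case: asboolP.
    have := ve (ptriv c); rewrite v0 !linear0 /isnil.
    by case: asboolP.
  have J0 x (v : J x) : v = 0 by apply: eI => p; apply: U0.
  have [z _] := rhom_zero B J; exists z => x v.
  by rewrite [LHS]J0 [RHS]J0.
have [j ij ji] := ib c Xc.
have [h hE] : exists h : {linear B c -> U}, forall w, h w = e (f c (j w)).
  by apply: linear_of => a u v; rewrite (can2_linear ij ji) !linearP.
(* The graph of the morphism corresponding to [h]. It commutes with an arrow [a] because the values
   along [p] after [a] are values along [pcons a p]. *)
pose P x (w : B x) (v : J x) := forall p, e (rpath J p v) = h (rpath B p w).
have /dependent_choice_prop[g gP] :
    forall x, exists g : {linear B x -> J x}, forall w, P x w (g w).
  move=> x.
  apply: linear_graph => [w|w v v' hv hv'|a w w' v v' hv hv'].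
  - exact: eS (fun p => h (rpath B p w)).
  - by apply: eU => p; rewrite hv hv'.
  - by move=> p; rewrite !linearP /= hv hv'.
have [//|x y a w|g' g'E] := @rhom_of B J (fun x => g x).
- by move=> x a w w'; rewrite linearP.
- apply: eU => p; rewrite gP.
  by rewrite -[rpath J p _]/(rpath J (pcons a p) _) gP.
exists g' => x v; apply: eU => p /=; rewrite g'E gP -(rpath_comm i) hE ij.
by rewrite rpath_comm.
Qed.

(** A path from [x] longer than all those from [x] to [c] cannot be prolonged to [c], so no value
    along a path can detect its action. *)
Lemma coinduced_path_nilpotent c (U : lmodType k) J :
  interval_finite Q -> coinduced c U J -> path_nilpotent J.
Proof.
move=> fQ [e [_ eI]] x; have /finite_seqP[s es] := fQ x c.
exists (\max_(p <- s) qlen p)%N.+1 => y p dp v; apply: eI => q.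
have : (qlen (qcat p q) <= \max_(p <- s) qlen p)%N.
  have : [set` s] (qcat p q) by rewrite -es.
  by move=> /= qs; rewrite (leq_bigmax_seq (F := @qlen Q x c)).
by rewrite qlen_cat leqNgt (leq_trans dp (leq_addr _ _)).
Qed.

Lemma rel_injective_dsum X I J :
  rel_injective X I -> rel_injective X J -> rel_injective X (dsum I J).
Proof.
move=> iI iJ A B i ib f.
have [p1 p1E] := dsum_fst I J; have [p2 p2E] := dsum_snd I J.
have [g1 g1E] := iI A B i ib (rhom_comp p1 f).
have [g2 g2E] := iJ A B i ib (rhom_comp p2 f).
have [g gE] := dsum_pair g1 g2; exists g => x v /=.
rewrite gE [g1 x _]g1E [g2 x _]g2E /= p1E p2E.
by case: (f x v).
Qed.

Lemma rpath_dsum M N x y (p : qpath x y) (v : dsum M N x) :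
  rpath (dsum M N) p v = (rpath M p v.1, rpath N p v.2).
Proof.
by elim: p v => [z|x' y' z a r IH] v /=; [case: v | rewrite IH].
Qed.

(** The socle condition stays inside the induction: it passes to summands and across isomorphisms,
    since these embed. *)
Lemma in_Inj_rel_injective X J :
  interval_finite Q -> in_Inj J -> socle_in X J -> rel_injective X J.
Proof.
move=> fQ; elim=> {J} [c U J bJ|_|I J _ IHI _ IHJ sIJ|I J [f [g [gf fg]]] _ IH sJ].
- by move=> sJ; apply: coinduced_rel_injective sJ; apply: tensor_coinduced bJ.
- move=> A B i _ f; have [z _] := rhom_zero B (rep0 k Q).
  by exists z => x v; apply/rowP => -[].
- have [i1 i1E] := dsum_inl I J; have [i2 i2E] := dsum_inr I J.
  apply: rel_injective_dsum; [apply: IHI|apply: IHJ].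
    exact: socle_in_mono (dsum_inl_inj i1E) sIJ.
  exact: socle_in_mono (dsum_inr_inj i2E) sIJ.
- apply: (rel_injective_retract fg); apply: IH.
  exact: socle_in_mono (section_inj gf) sJ.
Qed.

Lemma in_Inj_path_nilpotent J :
  interval_finite Q -> in_Inj J -> path_nilpotent J.
Proof.
move=> fQ; elim=> {J} [c U J bJ||I J _ nI _ nJ|I J [f [g [gf fg]]] _ nI].
- by apply: coinduced_path_nilpotent => //; apply: tensor_coinduced bJ.
- by move=> x; exists 0%N => y p _ v; apply/rowP => -[].
- move=> x; have [d dI] := nI x; have [d' dJ] := nJ x.
  exists (maxn d d') => y p; rewrite geq_max => /andP[dp d'p] v.
  by rewrite rpath_dsum dI ?dJ.
- exact: path_nilpotent_mono (section_inj fg) nI.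
Qed.

End Morphisms.

(** * The Fitting null component of an endomorphism, the union of the kernels of its powers *)

Section NilPart.
Variables (k : fieldType) (Q : quiver) (M : rep k Q) (h : rhom M M).

Definition in_nil (x : Q) : {pred M x} :=
  fun v => `[< exists d, iter d (h x) v = 0 >].

Lemma iter_rhom0 x d : iter d (h x) 0 = 0.
Proof. by elim: d => //= d ->; rewrite linear0. Qed.

Lemma iter_rhomP x d a (u v : M x) :
  iter d (h x) (a *: u + v) = a *: iter d (h x) u + iter d (h x) v.
Proof. by elim: d => //= d ->; rewrite linearP. Qed.

Lemma iter_rhom_comm x y (a : arrow x y) d (v : M x) :
  iter d (h y) (rmap M a v) = rmap M a (iter d (h x) v).
Proof. by elim: d => //= d ->; rewrite rhom_comm. Qed.

Lemma in_nil_submod (x : Q) : submod_closed (@in_nil x).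
Proof.
split=> [|c u v /asboolP[d hu] /asboolP[d' hv]]; apply/asboolP.
  by exists 0%N.
exists (d' + d)%N; rewrite iter_rhomP iterD hu iter_rhom0 scaler0 add0r.
by rewrite addnC iterD hv iter_rhom0.
Qed.

HB.instance Definition _ (x : Q) :=
  GRing.isSubmodClosed.Build k (M x) (@in_nil x) (@in_nil_submod x).

Definition nil_space (x : Q) := {v : M x | v \in @in_nil x}.

HB.instance Definition _ (x : Q) := SubChoice.on (nil_space x).
HB.instance Definition _ (x : Q) :=
  [SubChoice_isSubLmodule of nil_space x by <:].

Section NilMap.
Variables (x y : Q) (a : arrow x y).

Lemma nil_map_subproof (v : nil_space x) : rmap M a (val v) \in @in_nil y.
Proof.
case: v => v /= /asboolP[d hv]; apply/asboolP; exists d.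
by rewrite iter_rhom_comm hv linear0.
Qed.

Definition nil_map (v : nil_space x) : nil_space y :=
  Sub (rmap M a (val v)) (nil_map_subproof v).

Lemma nil_map_linear : linear nil_map.
Proof. by move=> c u v; apply: val_inj; rewrite /= !linearP. Qed.

HB.instance Definition _ := GRing.isLinear.Build k (nil_space x)
  (nil_space y) *:%R nil_map nil_map_linear.
End NilMap.

Definition nil_part : rep k Q := @Rep k Q nil_space (fun x y a => nil_map a).

Lemma nil_part_incl :
  exists i : rhom nil_part M, forall x v, i x v = val v.
Proof. by apply: rhom_of => // x c u v; rewrite linearP. Qed.

End NilPart.

(** * Local nilpotency and the Fitting decomposition *)

Section Fitting.
Variables (k : fieldType) (Q : quiver).
Implicit Types M N J : rep k Q.

Definition locally_nilpotent M (f : rhom M M) : Prop :=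
  forall x v, exists d, iter d (f x) v = 0.

(** [f] lowers the socle filtration, which exhausts [J]. *)
Lemma socle_killer_nilpotent J (f : rhom J J) :
  path_nilpotent J ->
  (forall x (v : J x), (forall y (a : arrow x y), rmap J a v = 0) -> f x v = 0) ->
  locally_nilpotent f.
Proof.
move=> nJ f0 x v; have [d dJ] := nJ x; exists d.
have {dJ} : forall y (p : qpath x y), (d <= qlen p)%N ->
  rpath J p v = 0 by move=> y p dp; apply: dJ.
(* If paths of length above [d] kill [v], then [p] of length at least [d] sends [v] into the socle,
   which [f] kills; so paths of length at least [d] kill [f x v]. *)
elim: d v => [|d IH] v dv; first exact: dv _ (ptriv x) _.
rewrite iterSr; apply: IH => y p dp; rewrite -rpath_comm; apply: f0 => z a.
have -> : rmap J a (rpath J p v) = rpath J (qcat p (pcons a (ptriv z))) v.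
  by rewrite rpath_cat.
by apply: dv; rewrite qlen_cat addn1.
Qed.

(** Here [h] is [1 - n], inverted by the geometric series in [n], a finite sum on each vector. *)
Lemma one_sub_nilpotent_bij M (h n : rhom M M) :
  (forall x v, h x v + n x v = v) -> locally_nilpotent n ->
  (forall x, injective (h x)) /\ (forall x w, exists v, h x v = w).
Proof.
move=> hn nn; split=> x.
  (* A vector killed by [h] is fixed by [n], hence equal to all its iterates, one of which is 0. *)
  move=> u v e; apply/eqP; rewrite -subr_eq0; apply/eqP; have [d] := nn x (u - v).
  suff -> : iter d (n x) (u - v) = u - v by [].
  elim: d => //= d ->; rewrite -{2}(hn x (u - v)).
  by rewrite [h x _]linearB /= e subrr add0r.
move=> w; have [d] := nn x w.
(* Since [w] is [h x w + n x w], a preimage [v] of [n x w] gives the preimage [w + v] of [w]. *)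
elim: d w => [|d IH] w; first by move=> /= ->; exists 0; rewrite linear0.
rewrite iterSr => /IH[v hv]; exists (w + v).
by rewrite linearD /= hv hn.
Qed.

(** As [h + g = 1], the two commute, and writing a vector as [h v + g v] lowers one exponent at a
    time. This gives both that the null components meet in 0 and that they span [M]. *)
Lemma fitting M (h g : rhom M M) :
  (forall x v, h x v + g x v = v) -> locally_nilpotent (rhom_comp h g) ->
  isomorphic M (dsum (nil_part h) (nil_part g)).
Proof.
move=> hg nhg.
have hE x v : h x v = v - g x v by rewrite -{2}(hg x v) addrK.
have ghC x v : g x (h x v) = h x (g x v) by rewrite !hE linearB.
have gith x i v : g x (iter i (h x) v) = iter i (h x) (g x v).
  by elim: i => //= i <-; rewrite ghC.
have hitg x i v : h x (iter i (g x) v) = iter i (g x) (h x v).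
  by elim: i => //= i <-; rewrite ghC.
have [i1 i1E] := nil_part_incl h; have [i2 i2E] := nil_part_incl g.
have [s sE] := dsum_copair i1 i2.
have sI x : injective (s x).
  suff s0 w : s x w = 0 -> w = 0.
    move=> u v e; apply/eqP; rewrite -subr_eq0; apply/eqP/s0.
    by rewrite linearB /= e subrr.
  case: w => a b; rewrite sE i1E i2E /= => /eqP.
  rewrite addr_eq0 => /eqP ab.
  (* Double induction: [h x v] satisfies the hypotheses for [i] and [j.+1], [g x v] for [i.+1] and
     [j], and [v] is their sum. *)
  have cop i j v : iter i (h x) v = 0 -> iter j (g x) v = 0 -> v = 0.
    elim: i j v => [|i IHi] j v //; elim: j v => [|j IHj] v // hv gv.
    rewrite -(hg x v) (IHi j.+1 (h x v)) -?iterSr -?hitg ?gv ?linear0 //.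
    by rewrite (IHj (g x v)) -?iterSr -?gith ?hv ?linear0 ?addr0.
  have a0 : val a = 0.
    case/asboolP: (valP a) => i ai; case/asboolP: (valP b) => j bj.
    apply: (cop i j) => //; rewrite [\val a]ab -scaleN1r -[_ *: _]addr0.
    by rewrite iter_rhomP bj iter_rhom0 scaler0 addr0.
  have b0 : val b = 0 by apply/eqP; rewrite -oppr_eq0 -ab a0.
  by congr pair; apply: val_inj; rewrite ?a0 ?b0.
have sS x v : exists w, s x w = v.
  have add u w : (exists u', s x u' = u) -> (exists w', s x w' = w) ->
      exists t, s x t = u + w.
    by move=> [u' <-] [w' <-]; exists (u' + w'); rewrite linearD.
  (* The same splitting; once an exponent reaches 0, [w] lies in a single null component. *)
  have key i j w : iter i (h x) (iter j (g x) w) = 0 -> exists t, s x t = w.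
    elim: i j w => [|i IHi] j w.
      move=> /= gw; have wg : w \in @in_nil k Q M g x by apply/asboolP; exists j.
      by exists (0, Sub w wg : nil_space g x); rewrite sE i1E i2E /= add0r.
    elim: j w => [|j IHj] w.
      move=> /= hw; have wh : w \in @in_nil k Q M h x by apply/asboolP; exists i.+1.
      by exists (Sub w wh : nil_space h x, 0); rewrite sE i1E i2E /= addr0.
    move=> hgw; rewrite -(hg x w); apply: add.
      by apply: (IHi j.+1); rewrite -hitg -iterSr.
    by apply: IHj; rewrite -iterSr.
  (* By commutation the [d]-th power of [h g] is $h^d g^d$. *)
  have [d dv] := nhg x v; apply: (key d d); rewrite -dv.
  by elim: d v {dv} => // d IH v; rewrite !iterSr hitg IH.
have [t [ts st]] := rhom_inv sI sS; exists t, s; split=> //.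
Qed.

End Fitting.

(** * Functoriality of restriction to a subquiver *)

Local Notation rin S M x := (cut_in (svertex S x) (rspace M x)).
Local Notation rout S M x := (cut_out (svertex S x) (rspace M x)).

Section RestrictionFunctor.
Variables (k : fieldType) (Q : quiver) (S : subquiver Q).
Implicit Types K L M N : rep k Q.

Lemma cutoff_eq0 (P : Prop) (V : lmodType k) (v : cutoff P V) : ~ P -> v = 0.
Proof.
by move: v; rewrite /cutoff; case: asboolP => // _ v _; apply/rowP => -[].
Qed.

Lemma restr_map_in M x y (a : arrow x y) (v : restr M S x) : sarrow S a ->
  rmap (restr M S) a v = rin S M y (rmap M a (rout S M x v)).
Proof. by move=> Sa; rewrite /= /restr_map; case: asboolP. Qed.

Lemma restr_map_out M x y (a : arrow x y) (v : restr M S x) : ~ sarrow S a ->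
  rmap (restr M S) a v = 0.
Proof. by move=> nSa; rewrite /= /restr_map; case: asboolP. Qed.

Lemma restr_rhom_compE M N L (g : rhom N L) (f : rhom M N) :
  rhom_eq (restr_rhom (rhom_comp g f) S)
          (rhom_comp (restr_rhom g S) (restr_rhom f S)).
Proof.
move=> x v; have [Sx|nSx] := pselect (svertex S x).
  by rewrite /= cut_inK.
by rewrite [LHS]cutoff_eq0 // [RHS]cutoff_eq0.
Qed.

Lemma restr_rhom_idE M : rhom_eq (restr_rhom (rhom_id M) S) (rhom_id (restr M S)).
Proof. by move=> x v; rewrite /= cut_outK. Qed.

Lemma restr_rhom_ext M N (f g : rhom M N) :
  rhom_eq f g -> rhom_eq (restr_rhom f S) (restr_rhom g S).
Proof. by move=> fg x v; rewrite /= fg. Qed.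

Lemma restr_rhomK M N L (g : rhom N L) (f : rhom M N) (h : rhom M L) :
  rhom_eq (rhom_comp g f) h ->
  rhom_eq (rhom_comp (restr_rhom g S) (restr_rhom f S)) (restr_rhom h S).
Proof. by move=> gf x v; rewrite -(restr_rhom_ext gf) restr_rhom_compE. Qed.

Lemma restr_rhomK_id M N (g : rhom N M) (f : rhom M N) :
  rhom_eq (rhom_comp g f) (rhom_id M) ->
  rhom_eq (rhom_comp (restr_rhom g S) (restr_rhom f S)) (rhom_id (restr M S)).
Proof. by move=> /restr_rhomK gf x v; rewrite gf restr_rhom_idE. Qed.
End RestrictionFunctor.

(** * Position of [Omega] and [Sigma] in [Q'], and fullness of restriction to [Omega] *)

Section Main.
Variables (k : fieldType) (Q : quiver) (Q' Sigma Omega : subquiver Q).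
Hypothesis hQ' : full_subquiver Q' (whole Q).
Hypothesis hSigma : full_subquiver Sigma Q'.
Hypothesis hOmega : successor_closed Omega Q'.
Hypothesis haug : subquiver_le (augmented_complement Sigma Q') Omega.

Lemma Omega_sub x : svertex Omega x -> svertex Q' x.
Proof. exact: hOmega.1.1. Qed.

(** The arrow lies in [Q'] by fullness and is a path of length one there, so successor-closedness
    applies. *)
Lemma Omega_succ x y (a : arrow x y) :
  svertex Omega x -> svertex Q' y -> sarrow Omega a.
Proof.
move=> Ox Qy; have Q'a : sarrow Q' a by apply: hQ'.2 => //; apply: Omega_sub.
by have [] := hOmega.2 x y (pcons a (ptriv y)) Ox (conj Q'a Qy).
Qed.

Lemma notOmega_Sigma x : svertex Q' x -> ~ svertex Omega x -> svertex Sigma x.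
Proof.
move=> Qx nOx; apply: contrapT => nSx; apply: nOx.
by apply: haug.1; split=> //; apply: Or31.
Qed.

(** Otherwise the source of [a] would belong to the augmented complement of [Sigma], which [Omega]
    contains. *)
Lemma notOmega_arrow x y (a : arrow x y) :
  svertex Q' x -> svertex Q' y -> ~ svertex Omega x -> sarrow Sigma a.
Proof.
move=> Qx Qy nOx; apply: contrapT => nSa; apply: nOx.
have Q'a : sarrow Q' a by apply: hQ'.2.
by apply: haug.1; split=> //; apply: Or32; exists y, a.
Qed.

(** Each of these conditions passes to retracts, whereas the definition of [in_Inj] has no closure
    under summands. They can thus be checked on [dsum M N] and inherited by [M], [N] and their
    summands. *)
Definition admissible (K : rep k Q) : Prop :=
  [/\ forall x (v : K x), v != 0 -> svertex Q' x,
      rel_injective (svertex Omega) (restr K Sigma),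
      path_nilpotent (restr K Sigma)
    & socle_in (svertex Omega) (restr K Sigma)].

Lemma admissible_retract (K L : rep k Q) (s : rhom K L) (r : rhom L K) :
  rhom_eq (rhom_comp r s) (rhom_id K) -> admissible L -> admissible K.
Proof.
move=> rs [QL iL nL sL].
have rsS := restr_rhomK_id (S := Sigma) rs.
split.
- move=> x v v0; apply: (QL x (s x v)); apply: contra_neq v0 => e.
  by apply: (section_inj rs); rewrite e linear0.
- exact: rel_injective_retract rsS iL.
- exact: path_nilpotent_mono (section_inj rsS) nL.
- exact: socle_in_mono (section_inj rsS) sL.
Qed.

Lemma admissible_out (K : rep k Q) x (v : K x) :
  admissible K -> ~ svertex Q' x -> v = 0.
Proof. by move=> [QK _ _ _] nQx; apply/eqP; apply: contra_notT nQx; apply: QK. Qed.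

Lemma restr_rhom_full (K L : rep k Q) (g : rhom (restr K Omega) (restr L Omega)) :
  admissible K -> admissible L ->
  exists f : rhom K L, rhom_eq (restr_rhom f Omega) g.
Proof.
move=> aK aL; have [_ iL _ _] := aL.
pose O x := svertex Omega x; pose S x := svertex Sigma x.
(* The morphism [g] read on [K] and [L], zero outside [Omega]; it commutes with the arrows starting
   in [Omega]. *)
pose G x (v : K x) : L x := rout Omega L x (g x (rin Omega K x v)).
have Glin x : linear (@G x) by move=> c u v; rewrite /G !linearP.
have Gcomm x y (a : arrow x y) v : O x -> G y (rmap K a v) = rmap L a (G x v).
  move=> Ox; have [Qy|nQy] := pselect (svertex Q' y); last first.
    by rewrite [LHS](admissible_out _ aL) // [RHS](admissible_out _ aL).
  have Oa := Omega_succ a Ox Qy; have Oy : O y := sarrow_tgt Oa.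
  rewrite /G.
  have -> : rin Omega K y (rmap K a v) =
      rmap (restr K Omega) a (rin Omega K x v).
    by rewrite restr_map_in // cut_inK.
  by rewrite rhom_comm restr_map_in // cut_inK.
(* As [Omega] is successor-closed, [A] is a subrepresentation of [KS], with inclusion [i] bijective
   on [Omega]. Relative injectivity will extend [f0], which is [G] on [A], along [i]. *)
pose KS := restr K Sigma; pose A := restr KS Omega.
have Arestr x y (a : arrow x y) (v : A x) :
    rout Omega KS y (rmap A a v) = rmap KS a (rout Omega KS x v).
  have [Ox|nOx] := pselect (O x); last first.
    by rewrite [v](cutoff_eq0 _ nOx) !linear0.
  have [Oa|nOa] := pselect (sarrow Omega a).
    by rewrite restr_map_in // cut_inK //; apply: sarrow_tgt Oa.
  rewrite restr_map_out // linear0 restr_map_out // => Sa.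
  by apply: nOa; apply: Omega_succ => //; apply: hSigma.1.1; apply: sarrow_tgt Sa.
have [i iE] : exists i : rhom A KS,
    forall x v, i x v = rout Omega KS x v.
  by apply: rhom_of => // x c u v; rewrite linearP.
have ib x : O x -> bijective (i x).
  move=> Ox; exists (rin Omega KS x) => v; rewrite iE.
    exact: cut_outK.
  exact: cut_inK.
have [f0 f0E] : exists f0 : rhom A (restr L Sigma),
    forall x v, f0 x v = rin Sigma L x (G x (rout Sigma K x (rout Omega KS x v))).
  apply: rhom_of => [x c u v|x y a v]; first by rewrite !linearP Glin linearP.
  have [Ox|nOx] := pselect (O x); last first.
    rewrite [v](cutoff_eq0 _ nOx) !linear0.
    have G0 z : G z 0 = 0 by rewrite /G !linear0.
    by rewrite !G0 !linear0.
  rewrite Arestr; have [Sa|nSa] := pselect (sarrow Sigma a).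
    have Sx := sarrow_src Sa; have Sy := sarrow_tgt Sa.
    by rewrite !restr_map_in // !cut_inK // Gcomm.
  by rewrite !restr_map_out // linear0 /G !linear0.
have [h hi] := iL A KS i ib f0.
have hG x (w : K x) : S x -> O x -> rout Sigma L x (h x (rin Sigma K x w)) = G x w.
  move=> Sx Ox.
  have := hi x (rin Omega KS x (rin Sigma K x w)).
  rewrite /= iE f0E !cut_inK // => ->; exact: cut_inK.
(* Gluing: [G] on [Omega] and the extension [h] elsewhere. By [hG] they agree on the vertices common
   to [Sigma] and [Omega]. *)
pose F x (v : K x) : L x :=
  if pselect (O x) then G x v else rout Sigma L x (h x (rin Sigma K x v)).
have FO x v : O x -> F x v = G x v by rewrite /F; case: pselect.
have FS x v : ~ O x -> F x v = rout Sigma L x (h x (rin Sigma K x v)).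
  by rewrite /F; case: pselect.
have [x c u v|x y a v|f fE] := @rhom_of k Q K L F.
- have [Ox|nOx] := pselect (O x); first by rewrite !FO // Glin.
  by rewrite !FS // !linearP.
- have [Qx|nQx] := pselect (svertex Q' x); last first.
    rewrite (admissible_out v aK nQx) linear0.
    by rewrite /F; do 2![case: pselect => ?]; rewrite /G !linear0.
  have [Qy|nQy] := pselect (svertex Q' y); last first.
    by rewrite [LHS](admissible_out _ aL) // [RHS](admissible_out _ aL).
  have [Ox|nOx] := pselect (O x).
    by rewrite !FO ?Gcomm //; apply: sarrow_tgt (Omega_succ a Ox Qy).
  have Sa := notOmega_arrow a Qx Qy nOx.
  have Sx : S x := sarrow_src Sa; have Sy : S y := sarrow_tgt Sa.
  (* The target [y] lies in [Sigma], so [h] computes [F] there whether or not [y] is in [Omega]. *)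
  have -> : F y (rmap K a v) = 
      rout Sigma L y (h y (rin Sigma K y (rmap K a v))).
    have [Oy|nOy] := pselect (O y); last exact: FS.
    by rewrite FO // hG.
  rewrite FS //.
  have -> : rin Sigma K y (rmap K a v) = rmap KS a (rin Sigma K x v).
    by rewrite restr_map_in // cut_inK.
  by rewrite rhom_comm restr_map_in // cut_inK.
exists f => x v; have [Ox|nOx] := pselect (O x); last first.
  by rewrite [LHS](cutoff_eq0 _ nOx) [RHS](cutoff_eq0 _ nOx).
by rewrite /= fE FO // /G !cut_outK.
Qed.

(** * Endomorphisms restricting to zero or to the identity on [Omega] *)

Lemma restr_rhom0_nilpotent (K : rep k Q) (n : rhom K K) :
  admissible K -> (forall x v, restr_rhom n Omega x v = 0) -> locally_nilpotent n.
Proof.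
move=> aK n0; have [_ _ nK sK] := aK.
have nO x v : svertex Omega x -> n x v = 0.
  move=> Ox; have := n0 x (rin Omega K x v).
  by rewrite /= cut_inK // => e; rewrite -[LHS](cut_inK Ox) e linear0.
(* The socle of [restr K Sigma] lives on [Omega], where [n] is zero. Vertices outside [Omega] lie in
   [Sigma] unless [K] vanishes there. *)
have nS : locally_nilpotent (restr_rhom n Sigma).
  apply: socle_killer_nilpotent => // x v v0.
  have [->|/(sK x v v0) Ox] := eqVneq v 0; first by rewrite linear0.
  by rewrite /= nO // linear0.
move=> x v; have [Ox|nOx] := pselect (svertex Omega x).
  by exists 1%N; apply: nO.
have [Qx|nQx] := pselect (svertex Q' x); last first.
  by exists 0%N; apply: admissible_out aK nQx.
have Sx := notOmega_Sigma Qx nOx.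
have [d dv] := nS x (rin Sigma K x v); exists d.
apply: (can_inj (cut_inK Sx)); rewrite linear0 -dv.
by elim: d {dv} => //= d <-; rewrite cut_inK.
Qed.

Lemma restr_rhom_id_bij (K : rep k Q) (h : rhom K K) :
  admissible K -> rhom_eq (restr_rhom h Omega) (rhom_id _) ->
  (forall x, injective (h x)) /\ (forall x w, exists v, h x v = w).
Proof.
move=> aK h1.
have [n nE] : exists n : rhom K K, forall x v, n x v = v - h x v.
  apply: rhom_of => [x c u v|x y a v].
    by rewrite linearP scalerBr opprD addrACA.
  by rewrite rhom_comm linearB.
apply: (@one_sub_nilpotent_bij k Q K h n) => [x v|]; first by rewrite nE addrC subrK.
apply: restr_rhom0_nilpotent => // x v.
by rewrite /= nE linearB /= cut_outK [cut_in _ _ _]h1 subrr.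
Qed.

(** When [restr K Omega] is zero, the zero endomorphism of [K] restricts to the identity and is
    therefore injective. *)
Lemma admissible_is_zero (K : rep k Q) :
  admissible K -> is_zero (restr K Omega) -> is_zero K.
Proof.
move=> aK zK x [v v0]; move/eqP: v0; apply.
have [z zE] := rhom_zero K K.
have [|zI _] := @restr_rhom_id_bij K z aK; last by apply: (zI x); rewrite !zE.
move=> y w; apply/eqP; rewrite -subr_eq0; apply: contra_notT (zK y) => nz.
by eexists; apply: nz.
Qed.

(** * Transfer of sections, retractions and isomorphisms *)

Lemma restr_is_zero (K : rep k Q) : is_zero K -> is_zero (restr K Omega).
Proof.
move=> zK x [v v0]; apply: (zK x); exists (rout Omega K x v).
by apply: contra_neq v0 => e; rewrite -[v]cut_outK e linear0.
Qed.

(** Lift a left inverse on [Omega] to [g]. Then [g f] restricts to the identity, so it has an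
    inverse [t], and [t g] is a left inverse of [f]. *)
Lemma restr_sectionP (K L : rep k Q) (f : rhom K L) : admissible K -> admissible L ->
  is_section f <-> is_section (restr_rhom f Omega).
Proof.
move=> aK aL; split=> [[g gf]|[g0 gf]].
  by exists (restr_rhom g Omega); apply: restr_rhomK_id.
have [g gE] := restr_rhom_full g0 aL aK.
have [|hI hS] := @restr_rhom_id_bij K (rhom_comp g f) aK.
  by move=> x v; rewrite restr_rhom_compE /= [RHS]/= -[RHS]gf /= -gE.
have [t [th _]] := rhom_inv hI hS.
by exists (rhom_comp t g) => x v; apply: th.
Qed.

Lemma restr_retractionP (K L : rep k Q) (f : rhom K L) :
  admissible K -> admissible L ->
  is_retraction f <-> is_retraction (restr_rhom f Omega).
Proof.
move=> aK aL; split=> [[g fg]|[g0 fg]].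
  by exists (restr_rhom g Omega); apply: restr_rhomK_id.
have [g gE] := restr_rhom_full g0 aL aK.
have [|hI hS] := @restr_rhom_id_bij L (rhom_comp f g) aL.
  by move=> x v; rewrite restr_rhom_compE -[RHS]fg /= -gE.
have [t [_ ht]] := rhom_inv hI hS.
by exists (rhom_comp g t) => x v; apply: ht.
Qed.

(** A lift of an isomorphism is both a section and a retraction, hence bijective at every vertex. *)
Lemma restr_isomorphicP (K L : rep k Q) : admissible K -> admissible L ->
  isomorphic K L <-> isomorphic (restr K Omega) (restr L Omega).
Proof.
move=> aK aL; split=> [[f [g [gf fg]]]|[f0 [g0 [gf fg]]]].
  exists (restr_rhom f Omega), (restr_rhom g Omega).
  by split; apply: restr_rhomK_id.
have [f fE] := restr_rhom_full f0 aK aL.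
have [s sf] : is_section f.
  by apply/restr_sectionP => //; exists g0 => x v; rewrite -[RHS]gf /= -fE.
have [t ft] : is_retraction f.
  by apply/restr_retractionP => //; exists g0 => x v; rewrite -[RHS]fg /= -fE.
apply: (isomorphic_of_bij (f := f)) => [|x w]; first exact: section_inj sf.
by exists (t x w); apply: ft.
Qed.

Lemma retract_is_zero (K L : rep k Q) (s : rhom L K) (r : rhom K L) :
  admissible K -> rhom_eq (rhom_comp r s) (rhom_id L) ->
  is_zero (restr L Omega) -> is_zero L.
Proof.
by move=> aK rs; apply: admissible_is_zero; apply: admissible_retract rs aK.
Qed.

(** * Transfer of indecomposability *)

Lemma restr_indecomposable (K : rep k Q) : admissible K ->
  indecomposable K -> indecomposable (restr K Omega).
Proof.
move=> aK [nzK iK]; split=> [/(admissible_is_zero aK)//|A B [phi [psi [ps sp]]]].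
have [p1 p1E] := dsum_fst A B; have [i1 i1E] := dsum_inl A B.
(* A lift of the idempotent projecting onto [A]. It may fail to be idempotent, but [h (1 - h)]
   vanishes on [Omega], which is enough for [fitting]. *)
have [h hE] := restr_rhom_full (rhom_comp psi (rhom_comp i1 (rhom_comp p1 phi))) aK aK.
have [g gE] : exists g : rhom K K, forall x v, g x v = v - h x v.
  apply: rhom_of => [x c u v|x y a v].
    by rewrite linearP scalerBr opprD addrACA.
  by rewrite rhom_comm linearB.
have hP x (w : dsum A B x) :
    restr_rhom h Omega x (psi x w) = psi x (w.1, 0).
  by rewrite hE /= [phi x _]sp p1E i1E.
have gP x (w : dsum A B x) :
    restr_rhom g Omega x (psi x w) = psi x (0, w.2).
  rewrite /= gE linearB /= cut_outK -[cut_in _ _ _]/(restr_rhom h Omega x (psi x w)).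
  by rewrite hP -linearB; congr (psi x _); congr pair; rewrite /= ?subrr ?subr0.
have nhg : locally_nilpotent (rhom_comp h g).
  apply: restr_rhom0_nilpotent => // x v.
  rewrite restr_rhom_compE -[v]ps.
  rewrite -[LHS]/(restr_rhom h Omega x (restr_rhom g Omega x (psi x (phi x v)))).
  by rewrite gP hP; apply: linear0.
have inj0 (f : rhom K K) : is_zero (nil_part f) ->
    forall x v, restr_rhom f Omega x v = 0 -> v = 0.
  move=> zf x v; have [Ox|nOx _] := pselect (svertex Omega x); last exact: cutoff_eq0.
  rewrite /= => /(congr1 (rout Omega K x)); rewrite linear0 cut_inK // => f0.
  apply: (can_inj (@cut_outK _ _ _)); rewrite linear0; apply/eqP.
  apply: contra_notT (zf x) => nz.
  have nv : rout Omega K x v \in @in_nil k Q K f x by apply/asboolP; exists 1%N.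
  by exists (Sub (rout Omega K x v) nv : nil_space f x).
have psi0 x w : psi x w = 0 -> w = 0.
  by move=> e; rewrite -[w]sp /= e linear0.
have [|/inj0 h0|/inj0 g0] := iK _ _ (fitting _ nhg).
- by move=> x v; rewrite gE addrC subrK.
(* On [Omega], [h] kills the copy of [B], so a zero null component of [h] forces [B] to be zero;
   likewise for [g] and [A]. *)
- right=> x [b]; move/eqP; apply.
  have /psi0[] : psi x (0, b) = 0 by apply: h0; rewrite hP linear0.
  by [].
- left=> x [a]; move/eqP; apply.
  have /psi0[] : psi x (a, 0) = 0 by apply: g0; rewrite gP linear0.
  by [].
Qed.

(** A splitting of [K] restricts to one of [restr K Omega]. The summand whose restriction vanishes
    is zero, being a retract of the admissible [K]. *)
Lemma indecomposable_of_restr (K : rep k Q) : admissible K ->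
  indecomposable (restr K Omega) -> indecomposable K.
Proof.
move=> aK [nzK iK]; split=> [/restr_is_zero//|A B [phi [psi [ps sp]]]].
have [p1 p1E] := dsum_fst A B; have [i1 i1E] := dsum_inl A B.
have [p2 p2E] := dsum_snd A B; have [i2 i2E] := dsum_inr A B.
have retA : rhom_eq (rhom_comp (rhom_comp p1 phi) (rhom_comp psi i1)) (rhom_id A).
  by move=> x v; rewrite /= [phi x _]sp p1E i1E.
have retB : rhom_eq (rhom_comp (rhom_comp p2 phi) (rhom_comp psi i2)) (rhom_id B).
  by move=> x v; rewrite /= [phi x _]sp p2E i2E.
have [|zA|zB] := iK (restr A Omega) (restr B Omega).
(* The isomorphism is assembled from the restricted projections and inclusions; [rAB] and [rBA] make
   the cross terms vanish. *)
- have [zAB zABE] := rhom_zero A B; have [zBA zBAE] := rhom_zero B A.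
  have rA := restr_rhomK_id (S := Omega) retA.
  have rB := restr_rhomK_id (S := Omega) retB.
  have rAB : rhom_eq (rhom_comp (rhom_comp p2 phi) (rhom_comp psi i1)) zAB.
    by move=> x v; rewrite /= [phi x _]sp p2E i1E zABE.
  have rBA : rhom_eq (rhom_comp (rhom_comp p1 phi) (rhom_comp psi i2)) zBA.
    by move=> x v; rewrite /= [phi x _]sp p1E i2E zBAE.
  have {}rAB := restr_rhomK (S := Omega) rAB.
  have {}rBA := restr_rhomK (S := Omega) rBA.
  have [f fE] := dsum_pair (restr_rhom (rhom_comp p1 phi) Omega)
    (restr_rhom (rhom_comp p2 phi) Omega).
  have [g gE] := dsum_copair (restr_rhom (rhom_comp psi i1) Omega)
    (restr_rhom (rhom_comp psi i2) Omega).
  have z0 (K' L' : rep k Q) (z : rhom K' L') : (forall x v, z x v = 0) ->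
      forall x v, restr_rhom z Omega x v = 0.
    by move=> zE x v; rewrite /= zE linear0.
  exists f, g; split=> x v.
    have [Ox|nOx] := pselect (svertex Omega x); last first.
      by rewrite [LHS]cutoff_eq0 // [RHS]cutoff_eq0.
    rewrite -[LHS]/(g x (f x v)) gE fE /= !cut_inK // -linearD i1E i2E p1E p2E -linearD.
    rewrite -[RHS]cut_outK; congr (cut_in _ _ _); rewrite -[RHS]ps /=.
    by congr (psi x _); case: (phi x _) => a b; congr pair; rewrite /= ?addr0 ?add0r.
  rewrite -[LHS]/(f x (g x v)) fE gE !linearD.
  case: v => a b; congr pair.
    by rewrite [X in X + _]rA [X in _ + X]rBA (z0 _ _ _ zBAE) addr0.
  by rewrite [X in X + _]rAB [X in _ + X]rB (z0 _ _ _ zABE) add0r.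
- by left; apply: retract_is_zero retA zA.
- by right; apply: retract_is_zero retB zB.
Qed.

End Main.

Theorem theorem1p13 (Q : quiver) (k : fieldType)
    (Q' Sigma Omega : subquiver Q) (M N : rep k Q)
    (hQ : strongly_locally_finite Q)
    (hQ' : full_subquiver Q' (whole Q))
    (hM : in_Rep_minus M) (hN : in_Rep_minus N)
    (hsupp : supported_by (dsum M N) Q')
    (hSigma : full_subquiver Sigma Q')
    (hinj : injective_restricted (dsum M N) Sigma)
    (hOmega : successor_closed Omega Q')
    (hsoc : subquiver_le (socle_support (restr (dsum M N) Sigma)) Omega)
    (haug : subquiver_le (augmented_complement Sigma Q') Omega) :
  [/\ isomorphic M N <-> isomorphic (restr M Omega) (restr N Omega),
      indecomposable M <-> indecomposable (restr M Omega)
    & forall f : rhom M N,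
        (is_section f <-> is_section (restr_rhom f Omega)) /\
        (is_retraction f <-> is_retraction (restr_rhom f Omega))].
Proof.
have sX : socle_in (svertex Omega) (restr (dsum M N) Sigma).
  move=> x v v0 nz; apply: hsoc.1; split=> //.
  have sv : v \in @in_soc k Q (restr (dsum M N) Sigma) x by apply/asboolP.
  by exists (Sub v sv : soc_space (restr (dsum M N) Sigma) x).
(* Support, injectivity and socle conditions concern the sum, so admissibility is shown there and
   then passed to the retracts [M] and [N]. *)
have aX : admissible Q' Sigma Omega (dsum M N).
  split=> //; last exact: in_Inj_path_nilpotent hQ.2 hinj.
    by move=> x v nz; apply: hsupp.1; split=> //; exists v.
  exact: in_Inj_rel_injective hQ.2 hinj sX.
have [p1 p1E] := dsum_fst M N; have [i1 i1E] := dsum_inl M N.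
have [p2 p2E] := dsum_snd M N; have [i2 i2E] := dsum_inr M N.
have aM : admissible Q' Sigma Omega M.
  by apply: (admissible_retract (s := i1) (r := p1)) aX => x v; rewrite /= i1E p1E.
have aN : admissible Q' Sigma Omega N.
  by apply: (admissible_retract (s := i2) (r := p2)) aX => x v; rewrite /= i2E p2E.
split.
- exact: (restr_isomorphicP hQ' hSigma hOmega haug).
- split; first exact: (restr_indecomposable hQ' hSigma hOmega haug).
  exact: (indecomposable_of_restr haug).
- move=> f; split; first exact: (restr_sectionP hQ' hSigma hOmega haug).
  exact: (restr_retractionP hQ' hSigma hOmega haug).
Qed.
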